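(* Let $\Gamma$ be a totally ordered group, let $E$ be a finite set and let $\mathcal C\subseteq\Gamma_{\max}^E$. Then $M=(E,\mathcal C)$ is a left $\Gamma_{\max}$-matroid if and only if $\mathcal C$ satisfies (C0), (C1), (C2) and (C3)$'$ for any $X,Y\in\mathcal C$ and $e,f\in E$ such that $X_e=Y_e\neq0$ and $X_f>Y_f$, there is $Z\in\mathcal C$ with $Z_e=0$, $Z_f=X_f$, and $Z_g\le\max\{X_g,Y_g\}$ for all $g\in E$.
   Context: For a totally ordered group $(\Gamma,\cdot,<)$ (possibly non-abelian, order bi-invariant), $\Gamma_{\max}$ is the skew hyperfield on $\Gamma\cup\{0\}$ with multiplication extending $\Gamma$ and $0$ absorbing, hyperaddition $x\boxplus0=\{x\}$, $x\boxplus y=\{\max(x,y)\}$ for $x\ne y$ in $\Gamma$, $x\boxplus x=\{z\in\Gamma:z\le x\}\cup\{0\}$, and $0<x$ for $x\in\Gamma$ (so $-x=x$). For $X\in\Gamma_{\max}^E$, $\underline X=\{e:X_e\ne0\}$. The axioms: (C0) $0\notin\mathcal C$; (C1) $\alpha X\in\mathcal C$ for $X\in\mathcal C$, $\alpha\in\Gamma$; (C2) if $X,Y\in\mathcal C$ and $\underline X\subseteq\underline Y$ then $Y=\alpha X$ for some $\alpha\in\Gamma$; (C3) if $X,Y\in\mathcal C$ are a modular pair (no two distinct $X',Y'\in\mathcal C$ with $\underline{X'}\cup\underline{Y'}\subsetneq\underline X\cup\underline Y$) and $X_e=-Y_e\neq0$, then some $Z\in\mathcal C$ has $Z_e=0$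 and $Z_g\in X_g\boxplus Y_g$ for all $g$. A left $\Gamma_{\max}$-matroid is a pair $(E,\mathcal C)$ satisfying (C0)–(C3).
   Formalization: In the definition of a modular pair, X and Y are required to have different supports, and ''no two distinct X', Y''' is taken to mean no two with distinct supports; with distinct vectors, as literally written, the equivalence fails. *)

(* Defs.v *)
From HB Require Import structures.
From mathcomp Require Import all_boot all_order.
From mathcomp Require Import monoid.

Set Implicit Arguments.
Unset Strict Implicit.
Unset Printing Implicit Defensive.

Import Order.TTheory.
Local Open Scope order_scope.
Local Open Scope group_scope.

(* The group may be non-abelian, so invariance is required on both sides. *)
HB.mixin Record isBiOrderedGroup (d : Order.disp_t) G
    of Group G & Order.Total d G := {
  ltg_mul2l : forall z x y : G, (x < y)%O -> (z * x < z * y)%O;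
  ltg_mul2r : forall z x y : G, (x < y)%O -> (x * z < y * z)%O;
}.

#[short(type="orderedGroupType")]
HB.structure Definition OrderedGroup (d : Order.disp_t) :=
  {G of Group G & Order.Total d G & isBiOrderedGroup d G}.

(* The carrier of Gamma_max: [None] is the adjoined zero. *)
Definition gmax (d : Order.disp_t) (Gamma : orderedGroupType d) : Type :=
  option Gamma.

HB.instance Definition _ (d : Order.disp_t) (Gamma : orderedGroupType d) :=
  Choice.copy (gmax Gamma) (option Gamma).

Section GammaMax.
Variables (d : Order.disp_t) (Gamma : orderedGroupType d).
Implicit Types x y z : gmax Gamma.

Definition gmax0 : gmax Gamma := None.

Definition gmax_le x y : bool :=
  match x, y with
  | None, _ => true
  | Some _, None => false
  | Some a, Some b => (a <= b)%O
  end.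

Definition gmax_lt x y : bool :=
  match x, y with
  | _, None => false
  | None, Some _ => true
  | Some a, Some b => (a < b)%O
  end.

Fact gmax_lt_def x y : gmax_lt x y = (y != x) && gmax_le x y.
Proof. by case: x y => [a|] [b|] //=; rewrite lt_def. Qed.

Fact gmax_le_anti : antisymmetric gmax_le.
Proof. by move=> [a|] [b|] //= /le_anti ->. Qed.

Fact gmax_le_trans : transitive gmax_le.
Proof. by move=> [b|] [a|] [c|] //=; apply: le_trans. Qed.

Fact gmax_le_total : total gmax_le.
Proof. by move=> [a|] [b|] //=; apply: le_total. Qed.

HB.instance Definition _ :=
  @Order.isOrder.Build d (gmax Gamma) gmax_le gmax_lt _ _ gmax_lt_def
    (fun _ _ => erefl) (fun _ _ => erefl)
    gmax_le_anti gmax_le_trans gmax_le_total.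

Definition gmax_mul x y : gmax Gamma :=
  match x, y with
  | Some a, Some b => Some (a * b)
  | _, _ => None
  end.

(* [gmax_hadd x y z] means that z is in the hypersum of x and y. *)
Definition gmax_hadd x y z : Prop :=
  match x, y with
  | _, None => z = x
  | None, _ => z = y
  | Some a, Some b => if a == b then is_true (z <= x)%O else z = Order.max x y
  end.

Definition gmax_opp x : gmax Gamma := x.

(* [gmax_opp] is the hyperinverse: it returns the only y whose hypersum with x
   contains zero. *)
Lemma gmax_oppP x y : gmax_hadd x y gmax0 <-> y = gmax_opp x.
Proof.
rewrite /gmax_hadd /gmax_opp /gmax0.
case: x y => [a|] [b|] //=.
case: eqP => [->|nab] //; split=> [|[] eba]; last by case: nab.
by rewrite maxEle; case: ifP.
Qed.

Variable E : finType.
Implicit Types X Y Z : {ffun E -> gmax Gamma}.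
Implicit Type C : {ffun E -> gmax Gamma} -> Prop.

Definition vec0 : {ffun E -> gmax Gamma} := [ffun=> gmax0].

Definition vscale (a : Gamma) X : {ffun E -> gmax Gamma} :=
  [ffun e => gmax_mul (Some a) (X e)].

Definition vsupp X : {set E} := [set e | X e != gmax0].

Definition is_support C (A : {set E}) : Prop := exists2 X, C X & vsupp X = A.

(* Modularity is a property of the supports: "distinct" has to mean distinct
   supports, since, unless Gamma is trivial, every nonzero vector in C has
   distinct multiples with the same support.
   A modular pair itself consists of two different supports. *)
Definition modular_pair C X Y : Prop :=
  vsupp X <> vsupp Y /\
  ~ (exists A B : {set E}, [/\ is_support C A, is_support C B, A <> B
       & A :|: B \proper vsupp X :|: vsupp Y]).

Definition axC0 C : Prop := ~ C vec0.

Definition axC1 C : Prop := forall X (a : Gamma), C X -> C (vscale a X).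

Definition axC2 C : Prop := forall X Y, C X -> C Y ->
  vsupp X \subset vsupp Y -> exists a : Gamma, Y = vscale a X.

Definition axC3 C : Prop := forall X Y (e : E), C X -> C Y ->
  modular_pair C X Y -> X e = gmax_opp (Y e) -> X e <> gmax0 ->
  exists Z, [/\ C Z, Z e = gmax0 & forall g, gmax_hadd (X g) (Y g) (Z g)].

Definition axC3' C : Prop := forall X Y (e f : E), C X -> C Y ->
  X e = Y e -> X e <> gmax0 -> (Y f < X f)%O ->
  exists Z, [/\ C Z, Z e = gmax0, Z f = X f
    & forall g, (Z g <= Order.max (X g) (Y g))%O].

Definition left_gmax_matroid C : Prop :=
  [/\ axC0 C, axC1 C, axC2 C & axC3 C].

End GammaMax.

(* Main.v *)
(** (C3)' gives (C3) because in a modular pair all circuits inside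
    [supp X :|: supp Y] avoiding [e] are proportional, and the bound by
    [max (X, Y)] makes the eliminants for the various [f] equal.

    Conversely, induct on the size of [supp X :|: supp Y], and among the failing
    pairs with a given [X f] take one whose maximum [W] is pointwise minimal; by
    (C2) there are finitely many candidates. The pair is not modular, so
    elimination in the underlying matroid yields a circuit [V] inside [supp W]
    missing a point [p] of [supp Y \ supp X] and a point [p'] of
    [supp X \ supp Y]. Scale [V] so that [V <= W] with equality at some [q].
    If [V f = W f], then [(V, Y)] is a failing pair whose maximum vanishes at
    [p']; if [V f < W f] and [V e = W e], then [(X, V)] is one vanishing at [p].
    Otherwise, the induction hypothesis eliminates [q] from [X] (if
    [X q = W q]) and from [Y] using [V], which gives a failing pair with maximum
    smaller than [W] at [q]. *)
From Stdlib Require Import Classical.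
Require Import Defs.
From mathcomp Require Import all_boot all_order.
From mathcomp Require Import monoid.

Set Implicit Arguments.
Unset Strict Implicit.
Unset Printing Implicit Defensive.

Import Order.TTheory.

(** * Elimination in clutters of finite sets *)

Section SetElimination.
Variables (E : finType) (S : {set E} -> Prop).
Implicit Types (A B D U V : {set E}) (e p r : E).

Definition clutter := forall A B, S A -> S B -> A \subset B -> A = B.

Definition weak_elimination := forall A B e, S A -> S B -> A <> B ->
  e \in A -> e \in B -> exists2 D, S D & D \subset (A :|: B) :\ e.

Hypotheses (clutS : clutter) (weakS : weak_elimination).

(** Induction on the size of the union. If the set [D] from weak elimination misses [f], a point [g]
    of [D] outside [A] is eliminated from [B] and [D] keeping [e], then [e] from [A] and the result
    [F] keeping [f]. Both unions are smaller: the first misses [f], the second misses [g]. *)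
Lemma strong_elimination A B e f : S A -> S B ->
    e \in A -> e \in B -> f \in A -> f \notin B ->
  exists2 D, S D & (f \in D) && (D \subset (A :|: B) :\ e).
Proof.
have [n] := ubnP #|A :|: B|.
elim: n A B e f => // n IHn A B e f ltn SA SB eA eB fA fB.
have nAB : A <> B by move=> eqAB; rewrite -eqAB fA in fB.
have [D SD sD] := weakS SA SB nAB eA eB.
have [fD|fD] := boolP (f \in D); first by exists D => //; rewrite fD.
have eD : e \notin D by apply/negP => /(subsetP sD); rewrite !inE eqxx.
have sDU : D \subset A :|: B by apply: subset_trans sD (subsetDl _ _).
have [g gD gA] : exists2 g, g \in D & g \notin A.
  apply/subsetPn; apply/negP => sDA.
  by rewrite (clutS SD SA sDA) eA in eD.
have gB : g \in B by move: (subsetP sDU _ gD); rewrite inE (negbTE gA).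
have ltBD : #|B :|: D| < n.
  rewrite -ltnS; apply: leq_trans ltn; rewrite ltnS; apply: proper_card.
  apply/properP; split; first by rewrite subUset subsetUr sDU.
  by exists f; rewrite !inE ?fA // (negbTE fB) (negbTE fD).
have [F SF /andP[eF sF]] := IHn B D g e ltBD SB SD gB gD eB eD.
have sFU : F \subset A :|: B.
  by apply: subset_trans sF (subset_trans (subsetDl _ _) _);
     rewrite subUset subsetUr.
have gF : g \notin F by apply/negP => /(subsetP sF); rewrite !inE eqxx.
have fF : f \notin F.
  apply/negP => /(subsetP sF).
  by rewrite !inE (negbTE fB) (negbTE fD) andbF.
have ltAF : #|A :|: F| < n.
  rewrite -ltnS; apply: leq_trans ltn; rewrite ltnS; apply: proper_card.
  apply/properP; split; first by rewrite subUset subsetUl sFU.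
  by exists g; rewrite !inE ?gB ?orbT // (negbTE gA) (negbTE gF).
have [G SG /andP[fG sG]] := IHn A F e f ltAF SA SF eA eF fA fF.
exists G => //; rewrite fG; apply: subset_trans sG (setSD _ _).
by rewrite subUset subsetUl.
Qed.

Lemma avoid_point A B p : S A -> S B -> A <> B ->
  exists2 D, S D & D \subset (A :|: B) :\ p.
Proof.
move=> SA SB nAB.
have [pA|pA] := boolP (p \in A); last first.
  by exists A => //; rewrite subsetD1 subsetUl.
have [pB|pB] := boolP (p \in B); last first.
  by exists B => //; rewrite subsetD1 subsetUr.
exact: weakS.
Qed.

(** Two distinct members avoiding [p] suffice, as [avoid_point] then removes [q]. One is [V], which
    misses [p] and [r]; the other contains [r]: it is [D], or comes from eliminating [p] from [D]
    and one of [A], [B] while keeping [r]. If [p] lies in [D] only, [A] and [B] serve. *)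
Lemma avoid_two_points A B D r p q : S A -> S B -> S D -> A <> B ->
    r \in D -> r \notin A :|: B ->
  exists2 V, S V & V \subset (A :|: B :|: D) :\ p :\ q.
Proof.
move=> SA SB SD nAB rD rAB.
suff [A' [B' [SA' SB' nAB' sA' sB']]] : exists A' B', [/\ S A', S B', A' <> B',
    A' \subset (A :|: B :|: D) :\ p & B' \subset (A :|: B :|: D) :\ p].
  have [V SV sV] := avoid_point q SA' SB' nAB'.
  by exists V => //; apply: subset_trans sV (setSD _ _); rewrite subUset sA'.
have [V SV sV] := avoid_point p SA SB nAB.
have sVU : V \subset (A :|: B :|: D) :\ p.
  by apply: subset_trans sV (setSD _ _); apply: subsetUl.
have rV : r \notin V.
  by apply: contra rAB => /(subsetP sV); rewrite 2!inE => /andP[].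
have distinct (G : {set E}) : r \in G -> V <> G by move=> rG eVG; rewrite eVG rG in rV.
move: rAB; rewrite inE negb_or => /andP[rA rB].
have [pD|pD] := boolP (p \in D); last first.
  exists V, D; split=> //; first exact: distinct.
  by rewrite subsetD1 pD subsetUr.
have [pA|pA] := boolP (p \in A).
  have [G SG /andP[rG sG]] := strong_elimination SD SA pD pA rD rA.
  exists V, G; split=> //; first exact: distinct.
  apply: subset_trans sG (setSD _ _).
  by rewrite subUset subsetUr -setUA subsetUl.
have [pB|pB] := boolP (p \in B).
  have [G SG /andP[rG sG]] := strong_elimination SD SB pD pB rD rB.
  exists V, G; split=> //; first exact: distinct.
  apply: subset_trans sG (setSD _ _).
  by rewrite subUset subsetUr setUAC subsetUr.
exists A, B; split=> //; rewrite subsetD1 ?pA ?pB andbT.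
  by rewrite -setUA subsetUl.
by rewrite setUAC subsetUr.
Qed.

End SetElimination.

(** Each step down the strict order [R] removes the key of the new element from the finite set [A]
    of keys still available below, so the descent stops. *)
Lemma finite_key_minimal (T : Type) (F : finType) (P : T -> Prop)
    (R : T -> T -> Prop) (key : T -> F) (t0 : T) :
    (forall t, ~ R t t) -> (forall t u v, R t u -> R u v -> R t v) ->
    (forall t u, P t -> P u -> key t = key u -> t = u) -> P t0 ->
  exists2 t, P t & forall u, P u -> ~ R u t.
Proof.
move=> irrR trR injk.
suff main n (A : {set F}) t : #|A| <= n -> P t ->
    (forall u, P u -> R u t -> key u \in A) ->
  exists2 t, P t & forall u, P u -> ~ R u t.
  by move=> Pt0; apply: (main #|F| setT t0); rewrite ?cardsT // => u; rewrite inE.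
elim: n A t => [|n IHn] A t leA Pt sA;
  case: (classic (exists2 u, P u & R u t)) => [[u Pu Rut]|noR].
- move: leA; rewrite leqn0 cards_eq0 => /eqP A0.
  by have := sA u Pu Rut; rewrite A0 inE.
- by exists t => // u Pu Rut; apply: noR; exists u.
- apply: (IHn (A :\ key u) u) => //.
    by move: leA; rewrite (cardsD1 (key u)) (sA u Pu Rut).
  move=> v Pv Rvu; rewrite !inE (sA v Pv (trR _ _ _ Rvu Rut)) andbT.
  by apply/eqP => /(injk _ _ Pv Pu) eqvu; apply: (irrR u); rewrite -{1}eqvu.
- by exists t => // u Pu Rut; apply: noR; exists u.
Qed.

(** * Order and hyperaddition on the carrier *)

Section GammaMaxOrder.
Variables (d : Order.disp_t) (Gamma : orderedGroupType d).
Implicit Types (a b : Gamma) (x y z : gmax Gamma).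

Local Open Scope group_scope.
Local Open Scope order_scope.

Lemma gmax_le0x x : gmax0 Gamma <= x. Proof. by case: x. Qed.

Lemma gmax_lex0 x : (x <= gmax0 Gamma) = (x == gmax0 Gamma).
Proof. by case: x. Qed.

Lemma gmax_lt0x x : (gmax0 Gamma < x) = (x != gmax0 Gamma).
Proof. by case: x. Qed.

Lemma gmax_neq0 x : x != gmax0 Gamma -> exists a, x = Some a.
Proof. by case: x => // a _; exists a. Qed.

Lemma gmax_mul_eq0 a x : (gmax_mul (Some a) x == gmax0 Gamma) = (x == gmax0 Gamma).
Proof. by case: x. Qed.

Lemma gmax_mul1 x : gmax_mul (Some 1) x = x.
Proof. by case: x => //= b; rewrite mul1g. Qed.

Lemma gmax_mul_le1 a x : a <= 1 -> gmax_mul (Some a) x <= x.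
Proof.
case: x => // b; rewrite le_eqVlt => /orP[/eqP->|lta1].
  by rewrite gmax_mul1.
apply: ltW; change (a * b < b)%O.
by have := ltg_mul2r b _ _ lta1; rewrite mul1g.
Qed.

Lemma gmax_mul_lt1 a x : x != gmax0 Gamma -> a < 1 -> gmax_mul (Some a) x < x.
Proof.
case: x => // b _ lta1; change (a * b < b)%O.
by have := ltg_mul2r b _ _ lta1; rewrite mul1g.
Qed.

Lemma gmax_mul_gt1 a x : x != gmax0 Gamma -> 1 < a -> x < gmax_mul (Some a) x.
Proof.
case: x => // b _ lta1; change (b < a * b)%O.
by have := ltg_mul2r b _ _ lta1; rewrite mul1g.
Qed.

Lemma gmax_mul_div x y : x != gmax0 Gamma -> y != gmax0 Gamma ->
  exists a, gmax_mul (Some a) x = y.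
Proof.
case: x y => [b|] [c|] // _ _; exists (c * b^-1).
by rewrite /gmax_mul -mulgA mulVg mulg1.
Qed.

(** With the next two lemmas, hyperaddition becomes one condition: [z] is at most the maximum, with
    equality when [x] and [y] differ. *)
Lemma gmax_hadd_le x y z : gmax_hadd x y z -> z <= Order.max x y.
Proof.
case: x y => [a|] [b|] /=; rewrite /gmax_hadd.
- by case: eqP => [->|_] h; rewrite ?maxxx // h.
- by move->; rewrite le_max lexx.
- by move->; rewrite le_max lexx orbT.
- by move->; rewrite le_max lexx.
Qed.

Lemma gmax_hadd_neq x y z : x != y -> gmax_hadd x y z -> z = Order.max x y.
Proof.
case: x y => [a|] [b|] //=; rewrite /gmax_hadd.
by case: (a =P b) => [->|//]; rewrite eqxx.
Qed.

Lemma gmax_haddI x y z : z <= Order.max x y ->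
  (x != y -> z = Order.max x y) -> gmax_hadd x y z.
Proof.
case: x y => [a|] [b|]; rewrite /gmax_hadd.
- case: (a =P b) => [->|nab] lez eqz; first by move: lez; rewrite maxxx.
  by apply: eqz; apply/eqP => -[].
- by move=> _ ->.
- by move=> _ ->.
- by rewrite maxxx gmax_lex0 => /eqP.
Qed.

End GammaMaxOrder.

(** * Supports and scaling of vectors *)

Section Vectors.
Variables (d : Order.disp_t) (Gamma : orderedGroupType d) (E : finType).
Implicit Types (a b : Gamma) (X Y Z V W : {ffun E -> gmax Gamma}).
Implicit Type C : {ffun E -> gmax Gamma} -> Prop.

Local Open Scope group_scope.
Local Open Scope order_scope.

Lemma vsuppE X e : (e \in vsupp X) = (X e != gmax0 Gamma).
Proof. by rewrite inE. Qed.

Lemma vscale1 X : vscale 1 X = X.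
Proof. by apply/ffunP => g; rewrite ffunE gmax_mul1. Qed.

Lemma vsupp_scale a X : vsupp (vscale a X) = vsupp X.
Proof. by apply/setP => g; rewrite !vsuppE ffunE gmax_mul_eq0. Qed.

Lemma vsupp_le X W : (forall g, X g <= W g) -> vsupp X \subset vsupp W.
Proof.
move=> leXW; apply/subsetP => g; rewrite !vsuppE -!gmax_lt0x => lt0.
exact: lt_le_trans lt0 (leXW g).
Qed.

Lemma vsupp_le_max X Y Z : (forall g, Z g <= Order.max (X g) (Y g)) ->
  vsupp Z \subset vsupp X :|: vsupp Y.
Proof.
move=> leZ; apply/subsetP => g; rewrite in_setU !vsuppE -!gmax_lt0x => lt0.
by rewrite -lt_max; apply: lt_le_trans lt0 (leZ g).
Qed.

Lemma eq_of_supp C X Y e : axC2 C -> C X -> C Y ->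
  vsupp X \subset vsupp Y -> X e = Y e -> X e != gmax0 Gamma -> X = Y.
Proof.
move=> C2 CX CY sXY eXY nz; have [a eY] := C2 _ _ CX CY sXY.
suff a1 : a = 1 by rewrite eY a1 vscale1.
move: eXY; rewrite eY ffunE; case: (X e) nz => // b _ [eb].
by apply: (mulIg b); rewrite mul1g -eb.
Qed.

Lemma tight_scaling V W : V != vec0 Gamma E -> vsupp V \subset vsupp W ->
  exists a q, [/\ forall g, vscale a V g <= W g, vscale a V q = W q
                & W q != gmax0 Gamma].
Proof.
move=> nV sVW.
have [q0 q0V] : exists q, q \in vsupp V.
  apply/set0Pn; apply: contra nV => /eqP V0; apply/eqP/ffunP => g.
  rewrite ffunE; apply/eqP; have := in_set0 g.
  by rewrite -V0 vsuppE => /negbFE.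
(* The required scalar is the least ratio over the support of [V], with the inverse on the right
   since scalars act on the left. Both entries are nonzero there, so the default 1 is never read. *)
pose ratio g := odflt 1 (W g) * (odflt 1 (V g))^-1.
case: (arg_minP ratio q0V) => q mq qmin.
have qV : q \in vsupp V := mq.
exists (ratio q), q; split.
- move=> g; have [gV|] := boolP (g \in vsupp V); last first.
    by rewrite vsuppE negbK ffunE => /eqP->; rewrite gmax_le0x.
  have gW := subsetP sVW _ gV; have := qmin g gV; rewrite ffunE.
  move: gV gW; rewrite !vsuppE; move: (ratio q) => r; rewrite /ratio.
  case: (V g) (W g) => [v|] [w|] //= _ _.
  rewrite le_eqVlt => /orP[/eqP->|ltr]; first by rewrite -mulgA mulVg mulg1.
  apply: ltW; change (r * v < w)%O.
  by have := ltg_mul2r v _ _ ltr; rewrite -mulgA mulVg mulg1.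
- have := subsetP sVW _ qV; rewrite ffunE.
  move: qV; rewrite !vsuppE /ratio => Vq Wq.
  have [[v ->] [w ->]] := (gmax_neq0 Vq, gmax_neq0 Wq).
  by rewrite /gmax_mul /= -mulgA mulVg mulg1.
- by have := subsetP sVW _ qV; rewrite vsuppE.
Qed.

End Vectors.

(** * Circuits, and (C3)' implies (C3) *)

Section Matroid.
Variables (d : Order.disp_t) (Gamma : orderedGroupType d) (E : finType).
Variable C : {ffun E -> gmax Gamma} -> Prop.
Implicit Types (a b : Gamma) (X Y Z V W : {ffun E -> gmax Gamma}).

Hypotheses (C0 : axC0 C) (C1 : axC1 C) (C2 : axC2 C).

Local Open Scope group_scope.
Local Open Scope order_scope.

Lemma rescale_at X e (x : gmax Gamma) : C X -> X e != gmax0 Gamma ->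
    x != gmax0 Gamma ->
  exists X', [/\ C X', vsupp X' = vsupp X & X' e = x].
Proof.
move=> CX nz nx; have [a ea] := gmax_mul_div nz nx.
by exists (vscale a X); split; rewrite ?vsupp_scale ?ffunE //; apply: C1.
Qed.

Lemma supports_clutter : clutter (is_support C).
Proof.
move=> _ _ [X CX <-] [Y CY <-] sXY.
by have [a ->] := C2 CX CY sXY; rewrite vsupp_scale.
Qed.

Lemma supports_incomparable X Y e f : C X -> C Y -> X e = Y e ->
  X e != gmax0 Gamma -> X f != Y f -> ~~ (vsupp X \subset vsupp Y).
Proof.
move=> CX CY eXY nz; apply: contra => sXY.
by rewrite (eq_of_supp C2 CX CY sXY eXY nz).
Qed.

(* In a modular pair the eliminants of [e] are unique up to a scalar, and the
   bound by [max (X, Y)] pins down the scalar. *)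
Lemma circuit_elimination_modular : axC3' C -> axC3 C.
Proof.
move=> C3' X Y e CX CY [nXY noAB] eXY /eqP nz; rewrite /gmax_opp in eXY.
have elim f : X f != Y f -> exists Z, [/\ C Z, Z e = gmax0 Gamma,
    Z f = Order.max (X f) (Y f) & forall g, Z g <= Order.max (X g) (Y g)].
  case: (ltgtP (X f) (Y f)) => // [ltf|gtf] _.
  - have nz' : Y e <> gmax0 Gamma by rewrite -eXY; apply/eqP.
    have [Z [CZ Ze Zf leZ]] := C3' Y X e f CY CX (esym eXY) nz' ltf.
    by exists Z; split=> // g; rewrite maxC.
  - have [Z [CZ Ze Zf leZ]] := C3' X Y e f CX CY eXY (elimN eqP nz) gtf.
    by exists Z; split.
have [f fX fY] : exists2 f, f \in vsupp X & f \notin vsupp Y.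
  apply/subsetPn; apply/negP => sXY; apply: nXY.
  by apply: supports_clutter sXY; [exists X | exists Y].
move: fX fY; rewrite !vsuppE negbK => Xf /eqP Yf.
have nf : X f != Y f by rewrite Yf.
have [Z [CZ Ze Zf leZ]] := elim f nf.
exists Z; split=> // g; apply: gmax_haddI => // ng.
have [Z' [CZ' Ze' Zg' leZ']] := elim g ng.
(* Both supports miss [e], so if distinct they would violate modularity. *)
have sZ : vsupp Z = vsupp Z'.
  case: (eqVneq (vsupp Z) (vsupp Z')) => // /eqP nZZ'; case: noAB.
  exists (vsupp Z), (vsupp Z'); split=> //; [by exists Z | by exists Z' |].
  apply/properP; split; first by rewrite subUset !vsupp_le_max.
  by exists e; rewrite in_setU !vsuppE ?nz // Ze Ze' eqxx.
have sub : vsupp Z \subset vsupp Z' by rewrite sZ.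
have [a eZ'] := C2 CZ CZ' sub.
have Zg0 : Z' g != gmax0 Gamma.
  by rewrite Zg' -gmax_lt0x lt_max !gmax_lt0x; move: ng;
     case: (X g) (Y g) => [?|] [?|].
have Zg1 : Z g != gmax0 Gamma by rewrite -(vsuppE Z) sZ vsuppE.
(* If [a < 1], then [Z] breaks the bound at [g], where [Z'] attains it; if [a > 1], then [Z'] breaks
   it at [f], where [Z] attains it. *)
case: (ltgtP a 1) => [lta|gta|a1]; last by rewrite -Zg' eZ' a1 vscale1.
- have := lt_le_trans (gmax_mul_lt1 Zg1 lta) (leZ g).
  by rewrite -Zg' eZ' ffunE ltxx.
- have Zf0 : Z f != gmax0 Gamma.
    by rewrite Zf -gmax_lt0x lt_max !gmax_lt0x Xf.
  by have := leZ' f; rewrite -Zf eZ' ffunE leNgt gmax_mul_gt1.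
Qed.

(** * (C3) implies (C3)' *)

Hypothesis C3 : axC3 C.

(** A pair that is not modular is replaced by one with a smaller union; a modular one is rescaled to
    agree at [e], and (C3) applies. *)
Lemma supports_weak_elimination : weak_elimination (is_support C).
Proof.
move=> A B e; have [n] := ubnP #|A :|: B|.
elim: n A B => // n IHn A B ltn SA SB nAB eA eB.
case: (classic (exists A' B' : {set E}, [/\ is_support C A', is_support C B',
    A' <> B' & A' :|: B' \proper A :|: B])) => [[A' [B' [SA' SB' nAB' ltU]]]|mod].
  have sU : (A' :|: B') :\ e \subset (A :|: B) :\ e.
    by apply: setSD; apply: proper_sub.
  have [eA'|eA'] := boolP (e \in A'); last first.
    by exists A' => //; apply: subset_trans sU; rewrite subsetD1 subsetUl.
  have [eB'|eB'] := boolP (e \in B'); last first.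
    by exists B' => //; apply: subset_trans sU; rewrite subsetD1 subsetUr.
  have [|D SD sD] := IHn A' B' _ SA' SB' nAB' eA' eB'.
    by rewrite -ltnS; apply: leq_trans ltn; rewrite ltnS; apply: proper_card.
  by exists D => //; apply: subset_trans sU.
case: SA SB => [X CX eX] [Y CY eY].
move: eA eB; rewrite -eX -eY !vsuppE => Xe Ye.
have [Y' [CY' sY' eY']] := rescale_at CY Ye Xe.
have modXY : modular_pair C X Y' by rewrite /modular_pair sY' eX eY.
have [Z [CZ Ze hZ]] := C3 CX CY' modXY (esym eY') (elimN eqP Xe).
exists (vsupp Z); first by exists Z.
rewrite -sY' subsetD1 vsuppE Ze eqxx andbT.
by apply: vsupp_le_max => g; apply: gmax_hadd_le.
Qed.

(** Non-modularity provides [A] and [B] whose union misses some [r]; whichever support contains [r]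
    is the third set for [avoid_two_points]. *)
Lemma nonmodular_avoid X Y p q : C X -> C Y -> vsupp X <> vsupp Y ->
    ~ modular_pair C X Y ->
  exists V, [/\ C V, vsupp V \subset vsupp X :|: vsupp Y,
                V p = gmax0 Gamma & V q = gmax0 Gamma].
Proof.
move=> CX CY nXY nmod.
have [A [B [SA SB nAB /properP[sU [r rU rAB]]]]] :
    exists A B : {set E}, [/\ is_support C A, is_support C B, A <> B
       & A :|: B \proper vsupp X :|: vsupp Y].
  by apply: NNPP => noAB; apply: nmod.
have [D [SD rD sD]] : exists D, [/\ is_support C D, r \in D
    & D \subset vsupp X :|: vsupp Y].
  move: rU; rewrite inE => /orP[rX|rY].
    by exists (vsupp X); split; rewrite ?subsetUl //; exists X.
  by exists (vsupp Y); split; rewrite ?subsetUr //; exists Y.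
have [_ [V CV <-] sV] := avoid_two_points supports_clutter
  supports_weak_elimination p q SA SB SD nAB rD rAB.
have notin x : x \notin vsupp V -> V x = gmax0 Gamma.
  by rewrite vsuppE negbK => /eqP.
exists V; split=> //.
- apply: subset_trans sV _.
  by rewrite setDDl; apply: subset_trans (subsetDl _ _) _; rewrite subUset sU.
- by apply: notin; apply/negP => /(subsetP sV); rewrite !inE eqxx andbF.
- by apply: notin; apply/negP => /(subsetP sV); rewrite !inE eqxx.
Qed.

Definition eliminable e f X Y := [/\ C X, C Y, X e = Y e, X e != gmax0 Gamma
  & Y f < X f].

Definition vmax X Y : {ffun E -> gmax Gamma} := [ffun g => Order.max (X g) (Y g)].

Lemma vsupp_vmax X Y : vsupp (vmax X Y) = vsupp X :|: vsupp Y.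
Proof.
by apply/setP => g; rewrite in_setU !vsuppE ffunE -!gmax_lt0x lt_max.
Qed.

(** By (C2), the fixed nonzero [f]-entry and the support determine the first vector, whose [e]-entry
    and the other support then determine the second. Pairs of supports are thus a finite key. *)
Lemma minimal_eliminable e f X Y : eliminable e f X Y ->
  exists X' Y', [/\ eliminable e f X' Y', X' f = X f,
    forall g, vmax X' Y' g <= vmax X Y g &
    forall X'' Y'', eliminable e f X'' Y'' -> X'' f = X' f ->
      (forall g, vmax X'' Y'' g <= vmax X' Y' g) -> vmax X'' Y'' = vmax X' Y'].
Proof.
move=> elXY.
pose vec : Type := {ffun E -> gmax Gamma}.
pose P (t : vec * vec) := [/\ eliminable e f t.1 t.2, t.1 f = X f
  & forall g, vmax t.1 t.2 g <= vmax X Y g].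
pose R (t u : vec * vec) := (forall g, vmax t.1 t.2 g <= vmax u.1 u.2 g) /\
  vmax t.1 t.2 <> vmax u.1 u.2.
have irrR t : ~ R t t by case.
have trR t u v : R t u -> R u v -> R t v.
  move=> [letu ntu] [leuv nuv]; split=> [g|eqtv].
    exact: le_trans (letu g) (leuv g).
  apply: ntu; apply/ffunP => g; apply: le_anti.
  by rewrite letu eqtv leuv.
pose key (t : vec * vec) := (vsupp t.1, vsupp t.2).
have injk t u : P t -> P u -> key t = key u -> t = u.
  case: t u => [X1 Y1] [X2 Y2] [/= [CX1 CY1 e1 n1 lt1] f1 _].
  move=> [/= [CX2 CY2 e2 n2 lt2] f2 _] [sX sY].
  have Xf : X1 f != gmax0 Gamma.
    by rewrite -gmax_lt0x; apply: le_lt_trans lt1; apply: gmax_le0x.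
  have eX : X1 = X2.
    by apply: (eq_of_supp (e := f) C2); rewrite ?sX // f1 f2.
  congr (_, _) => //.
  by apply: (eq_of_supp (e := e) C2); rewrite ?sY // -?e1 -?e2 ?eX.
have PXY : P (X, Y) by split.
have [[X' Y'] [/= elX' fX' leX'] minX'] :=
  finite_key_minimal irrR trR injk PXY.
exists X', Y'; split=> // X'' Y'' elX'' fX'' leX''.
apply: NNPP => nW; apply: (minX' (X'', Y'')); last by split.
split=> //=; first by rewrite fX''.
by move=> g; apply: le_trans (leX'' g) (leX' g).
Qed.

Lemma circuit_elimination : axC3' C.
Proof.
suff main n X Y e f : (#|vsupp X :|: vsupp Y| < n)%N -> eliminable e f X Y ->
    exists Z, [/\ C Z, Z e = gmax0 Gamma, Z f = X f
      & forall g, Z g <= Order.max (X g) (Y g)].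
  move=> X Y e f CX CY eXY /eqP Xe ltf.
  exact: (main _ X Y e f (ltnSn _)).
elim: n X Y e f => // n IHn X0 Y0 e f ltn el0; apply: NNPP => noZ0.
have [X [Y [[CX CY eXY Xe ltf] Xf0 leW min]]] := minimal_eliminable el0.
set W := vmax X Y in leW min.
(* An eliminant bounded by [W] would also serve for [(X0, Y0)]. *)
have noZ Z : C Z -> Z f = X f -> (forall g, Z g <= W g) -> Z e != gmax0 Gamma.
  move=> CZ Zf leZ; apply/negP => /eqP Ze.
  apply: noZ0; exists Z; split=> //; first by rewrite Zf.
  by move=> g; have := le_trans (leZ g) (leW g); rewrite [vmax X0 Y0 g]ffunE.
have leXW g : X g <= W g by rewrite ffunE le_max lexx.
have leYW g : Y g <= W g by rewrite ffunE le_max lexx orbT.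
have We : W e = X e by rewrite ffunE -eXY maxxx.
have Wf : W f = X f by rewrite ffunE max_l // ltW.
(* A common zero [p] inside the support of [W] makes the union of supports smaller, so induction
   applies with any [u], [v] as [e], [f]. *)
have IHW p Z V u v : p \in vsupp W -> Z p = gmax0 Gamma -> V p = gmax0 Gamma ->
    (forall g, Z g <= W g) -> (forall g, V g <= W g) -> eliminable u v Z V ->
  exists Z', [/\ C Z', Z' u = gmax0 Gamma, Z' v = Z v,
    forall g, Z' g <= W g & forall g, Z' g <= Order.max (Z g) (V g)].
  move=> pW Zp Vp leZ leV elZV.
  have [|Z' [CZ' Zu' Zv' leZ']] := IHn Z V u v _ elZV.
    rewrite -ltnS; apply: leq_trans ltn; rewrite ltnS; apply: proper_card.
    apply: (@proper_sub_trans _ _ (mem (vsupp W))).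
      apply/properP; split; first by rewrite subUset !vsupp_le.
      by exists p; rewrite // in_setU !vsuppE Zp Vp eqxx.
    by rewrite -vsupp_vmax vsupp_le.
  exists Z'; split=> // g; apply: le_trans (leZ' g) _.
  by rewrite ge_max leZ leV.
have nXf : X f != Y f by rewrite gt_eqF.
have Ye : Y e != gmax0 Gamma by rewrite -eXY.
have nYf : Y f != X f by rewrite eq_sym.
have [p' p'X p'Y] := subsetPn (supports_incomparable CX CY eXY Xe nXf).
have [p pY pX] := subsetPn (supports_incomparable CY CX (esym eXY) Ye nYf).
have pW : p \in vsupp W by rewrite vsupp_vmax inE pY orbT.
have p'W : p' \in vsupp W by rewrite vsupp_vmax inE p'X.
move: p'Y pX; rewrite !vsuppE !negbK => /eqP Yp' /eqP Xp.
have nmod : ~ modular_pair C X Y.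
  move=> mod; have [Z [CZ Ze hZ]] := C3 CX CY mod eXY (elimN eqP Xe).
  suff: Z e != gmax0 Gamma by rewrite Ze eqxx.
  apply: noZ => // [|g]; last by rewrite ffunE; apply: gmax_hadd_le.
  by rewrite (gmax_hadd_neq nXf (hZ f)) max_l // ltW.
have nXY : vsupp X <> vsupp Y.
  by move=> eqS; move: p'X; rewrite eqS vsuppE Yp' eqxx.
have scale_eq Z Y' : C Z -> C Y' -> Z f = W f -> Y' f < W f -> Z e = Y' e ->
    (forall g, Z g <= W g) -> (forall g, Y' g <= W g) -> vmax Z Y' = W.
  move=> CZ CY' Zf Yf' eZY leZ leY'; apply: min; last 2 first.
  - by rewrite Zf.
  - by move=> g; rewrite ffunE ge_max leZ leY'.
  split=> //; last by rewrite Zf.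
  by apply: noZ => //; rewrite Zf.
(* A multiple of [Y] with the same [e]-entry as [Z] pairs with [Z], so the
   minimality of [W] forces the [e]-entry of [Z] to be that of [W]. *)
have top_e Z : C Z -> Z f = W f -> (forall g, Z g <= W g) -> Z e = W e.
  move=> CZ Zf leZ.
  have Ze : Z e != gmax0 Gamma by apply: noZ; rewrite // Zf.
  have [a ea] := gmax_mul_div Ye Ze.
  have a1 : a <= 1.
    rewrite leNgt; apply/negP => /(gmax_mul_gt1 Ye); rewrite ea -eXY -We.
    by rewrite ltNge leZ.
  have leaY g : vscale a Y g <= Y g by rewrite ffunE gmax_mul_le1.
  have <- : vmax Z (vscale a Y) = W.
    apply: scale_eq => //; first exact: C1.
    - by rewrite Wf; apply: le_lt_trans (leaY f) ltf.
    - by rewrite ffunE ea.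
    - by move=> g; apply: le_trans (leaY g) (leYW g).
  by rewrite ffunE [vscale a Y e]ffunE ea maxxx.
(* By minimality such a pair attains [W] everywhere; what follows seeks a point where both vectors
   fall short. *)
have cover Z Y' g : C Z -> Z f = W f -> (forall h, Z h <= W h) -> C Y' ->
    Y' f < W f -> Y' e = W e -> (forall h, Y' h <= W h) ->
    Order.max (Z g) (Y' g) = W g.
  move=> CZ Zf leZ CY' Yf' Ye' leY'.
  have eqW : vmax Z Y' = W by apply: scale_eq => //; rewrite Ye' top_e.
  by rewrite -[RHS](congr1 (fun F : {ffun E -> gmax Gamma} => F g) eqW) ffunE.
have Yf : Y f < W f by rewrite Wf.
have YeW : Y e = W e by rewrite We.
(* The zero at [p] is shared with [X] and the one at [p'] with [Y], so [IHW] can use [V] against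
   either. *)
have [V0 [CV0 sV0 V0p V0p']] := nonmodular_avoid p p' CX CY nXY nmod.
have [||a [q [leV Vq Wq]]] := @tight_scaling _ _ _ V0 W.
- by apply/eqP => V00; apply: C0; rewrite -V00.
- by rewrite vsupp_vmax.
set V := vscale a V0 in leV Vq.
have CV : C V by apply: C1.
have Vp : V p = gmax0 Gamma by rewrite ffunE V0p.
have Vp' : V p' = gmax0 Gamma by rewrite ffunE V0p'.
have [VfW|VfW] := eqVneq (V f) (W f).
  have := cover V Y p' CV VfW leV CY Yf YeW leYW.
  by rewrite Vp' Yp' maxxx => W0; move: p'W; rewrite vsuppE -W0 eqxx.
have ltVf : V f < W f by rewrite lt_neqAle VfW leV.
have [VeW|VeW] := eqVneq (V e) (W e).
  have := cover X V p CX (esym Wf) leXW CV ltVf VeW leV.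
  by rewrite Vp Xp maxxx => W0; move: pW; rewrite vsuppE -W0 eqxx.
have ltVe : V e < W e by rewrite lt_neqAle VeW leV.
(* Now [V] is below [W] at both [e] and [f], so eliminating [q] with it can preserve the [f]-entry
   of [X] and the [e]-entry of [Y]. *)
have [X' [CX' Xf' leX' ltXq']] : exists X', [/\ C X', X' f = W f,
    forall g, X' g <= W g & X' q < W q].
  have [XqW|XqW] := eqVneq (X q) (W q); last first.
    by exists X; split=> //; rewrite lt_neqAle XqW leXW.
  have [|X' [CX' Xq' Xf' leX' _]] := @IHW p X V q f pW Xp Vp leXW leV.
    by split=> //; rewrite ?XqW // -Wf.
  by exists X'; split=> //; rewrite ?Xf' ?Xq' ?gmax_lt0x.
(* Since [X'] falls short at [q], [Y] must attain [W] there, and so agrees with [V] at [q]. *)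
have YqW : Y q = W q.
  have := cover X' Y q CX' Xf' leX' CY Yf YeW leYW.
  by case: leP => // _ eqX; rewrite eqX ltxx in ltXq'.
have [|Y' [CY' Yq' Ye' leY' leY'']] := @IHW p' Y V q e p'W Yp' Vp' leYW leV.
  by split=> //; rewrite ?YqW // YeW.
have ltYf' : Y' f < W f.
  by apply: le_lt_trans (leY'' f) _; rewrite gt_max Yf.
(* Both vectors are below [W] at [q], a contradiction. *)
have := cover X' Y' q CX' Xf' leX' CY' ltYf' _ leY'.
rewrite Yq' Ye' => /(_ YeW) eqW; move: ltXq'.
by rewrite -eqW lt_max ltxx ltNge gmax_le0x.
Qed.

End Matroid.

Theorem theorem25 (d : Order.disp_t) (Gamma : orderedGroupType d) (E : finType)
    (C : {ffun E -> gmax Gamma} -> Prop) :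
  left_gmax_matroid C <-> [/\ axC0 C, axC1 C, axC2 C & axC3' C].
Proof.
split=> -[C0 C1 C2 C3]; split=> //.
  exact: circuit_elimination.
exact: circuit_elimination_modular.
Qed.
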